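(* For all $p\in\mathbb{N}$, $p\ge1$, the family of matrices $\{\mathbf{B}_n^p\}_n$ is weakly well-conditioned. In particular, $\kappa_1(\mathbf{B}_n^p)=\mathcal{O}(n^2)$ as $n\to\infty$, where $\kappa_1$ is the condition number in the matrix norm $\|\cdot\|_1$.
   Context: Fix $T>0$. For $N\in\mathbb{N}$ let $h=T/N$, and for $p\ge 1$ let $\{\varphi_j^p\}_{j=0}^{N+p-1}$ be the B-spline basis (Cox–de Boor) of degree $p$ and maximal regularity $C^{p-1}$ on the uniform mesh of $[0,T]$ with $N$ intervals, with open knot vector (the end points $0$ and $T$ are repeated $p+1$ times, the interior knots $h,2h,\ldots,T-h$ are simple). Throughout $N\ge 3p+1$. Define, for $\ell,j=1,\ldots,N+p-1$, $\mathbf{B}_h^p[\ell,j]=\int_0^T\partial_t\varphi_j^p\,\partial_t\varphi_{\ell-1}^p\,dt$. With $n=N+p-1$ set $\mathbf{B}_n^p:=h\,\mathbf{B}_h^p\in\mathbb{R}^{n\times n}$. A family of matrices $\{\mathbf{A}_n\}_n$, $\mathbf{A}_n\in\mathbb{R}^{n\times n}$, is weakly well-conditioned if, for $n$ sufficiently large, the matrices $\mathbf{A}_n$ are invertible and their condition numbers $\kappa(\mathbf{A}_n)$ grow only algebraically in $n$, i.e. $\kappa(\mathbf{A}_n)=\mathcal{O}(n^{\alpha})$ for some $\alpha\ge0$ (this does not depend on which of the matrix norms $\|\cdot\|_1,\|\cdot\|_2,\|\cdot\|_\infty$ is used). *)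

(* Defs.v *)
From HB Require Import structures.
From mathcomp Require Import all_boot all_order all_algebra.
From mathcomp Require Import all_classical all_reals all_analysis.

Set Implicit Arguments.
Unset Strict Implicit.
Unset Printing Implicit Defensive.

Import Order.TTheory GRing.Theory Num.Theory.
Import numFieldNormedType.Exports.

Local Open Scope classical_set_scope.
Local Open Scope ring_scope.

Section Conditioning.
Variable R : realType.

Variant norm_index := norm_one | norm_two | norm_inf.

Definition vec_norm (q : norm_index) (n : nat) (x : 'cV[R]_n) : R :=
  match q with
  | norm_one => \sum_(i < n) `|x i 0|
  | norm_two => Num.sqrt (\sum_(i < n) `|x i 0| ^+ 2)
  | norm_inf => \big[Num.max/0]_(i < n) `|x i 0|
  end.

(* The norm that MathComp-Analysis puts on matrices is the entrywise maximum,
   not the operator norm induced by a vector norm. *)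
Definition op_norm (q : norm_index) (n : nat) (A : 'M[R]_n) : R :=
  sup [set vec_norm q (A *m x) | x in [set x : 'cV[R]_n | vec_norm q x <= 1]].

(* Meaningful for invertible A only: [invmx A] is A itself otherwise. *)
Definition cond_number (q : norm_index) (n : nat) (A : 'M[R]_n) : R :=
  op_norm q A * op_norm q (invmx A).

(* Requiring the bound for each of the three norms makes the definition
   independent of a choice of norm. *)
Definition weakly_well_conditioned (A : forall n : nat, 'M[R]_n) : Prop :=
  (\forall n \near \oo, A n \in unitmx) /\
  forall q : norm_index, exists2 alpha : R, 0 <= alpha &
    (fun n : nat => cond_number q (A n)) =O_\oo (fun n : nat => n%:R `^ alpha).

End Conditioning.

Section BSplines.
Variable R : realType.

Definition mesh_size (T : R) (N : nat) : R := T / N%:R.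

(* The open knot vector, indexed by 0, ..., N + 2p: the truncated subtraction
   and the minimum repeat each of 0 and T = N h exactly p + 1 times. *)
Definition knot (T : R) (N p i : nat) : R :=
  (minn (i - p) N)%:R * mesh_size T N.

(* Cox-de Boor recursion on the degree d, over the knot vector attached to p.
   The convention 0/0 = 0 is built in, since x / 0 = 0 in MathComp.  In degree
   zero the intervals are half-open, except that the last nondegenerate one,
   of index N + p - 1, is closed at T. *)
Fixpoint cox_de_boor (T : R) (N p d i : nat) (t : R) {struct d} : R :=
  let xi := knot T N p in
  match d with
  | 0 => ((xi i <= t < xi i.+1) ||
          ((i.+1 == N + p)%N && (t == xi i.+1)))%:R
  | d'.+1 =>
      (t - xi i) / (xi (i + d)%N - xi i) * cox_de_boor T N p d' i t +
      (xi (i + d).+1 - t) / (xi (i + d).+1 - xi i.+1) *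
        cox_de_boor T N p d' i.+1 t
  end.

Definition bspline (T : R) (N p j : nat) : R -> R := cox_de_boor T N p p j.

(* Entry [l, j] with the indices l, j counted from 1.  The B-splines may fail to
   be differentiable at the knots (p = 1) or at 0 and T, where they are extended
   by zero; these finitely many points do not contribute to the integral. *)
Definition Bh_entry (T : R) (N p l j : nat) : R :=
  (\int[@lebesgue_measure R]_(t in `[0, T])
     (derive1 (bspline T N p j) t * derive1 (bspline T N p l.-1) t))%R.

(* The family is indexed by the matrix size n = N + p - 1, whence
   N = n + 1 - p; N >= 3p + 1 amounts to n >= 4p. *)
Definition B_mx (T : R) (p n : nat) : 'M[R]_n :=
  let N := (n.+1 - p)%N in
  \matrix_(l < n, j < n) (mesh_size T N * Bh_entry T N p l.+1 j.+1).

End BSplines.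

(* Main.v *)
Require Import Defs.
From HB Require Import structures.
From mathcomp Require Import all_boot all_order all_algebra.
From mathcomp Require Import all_classical all_reals all_analysis.
From mathcomp Require Import measurable_realfun.
From mathcomp Require Import ring lra zify.

Set Implicit Arguments.
Unset Strict Implicit.
Unset Printing Implicit Defensive.

Import Order.TTheory GRing.Theory Num.Theory.
Import numFieldNormedType.Exports.

Local Open Scope classical_set_scope.
Local Open Scope ring_scope.

(** Why the theorem is true.

   Write the derivative of a B-spline of degree p as M_j - M_(j+1), where the
   M_i = p B_(i,p-1) / (xi_(i+p) - xi_i) are the B-splines of degree p-1 scaled
   to have integral 1.  The trial functions of the matrix are those that vanish
   at 0, its test functions those that vanish at T, so both families of
   derivatives are differences of the same M_1, ..., M_n, and M_0 = M_(n+1) = 0.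
   Hence B_n = - U G U, where U is the bidiagonal difference matrix and G is, up
   to the factor h, the Gram matrix of the M_i ([B_mx_factor]).  The inverse of
   U is the lower triangular matrix S of ones, whose norm is n, so that
   B_n^-1 = - S G^-1 S, and everything reduces to bounding the 1-norm of G^-1
   independently of n: the two factors S account for the growth n^2.

   After rescaling each mesh cell to [0, 1], h and T disappear from G.  The
   matrix G is banded with bounded entries, and it is coercive, i.e.
   x^T G x >= c |x|^2 with c depending on p alone ([gram_mx_coercive]).  This
   is the stability of the B-spline basis, and it is local: on one cell, the
   coefficients of the active B-splines are controlled by the polynomial that
   they sum to ([piece_stable]).  The proof goes by induction on the degree.  The
   derivative controls the differences of consecutive coefficients, and the
   partition of unity then controls the coefficients themselves.  Polynomials
   of bounded degree on [0, 1] form a finite-dimensional space, in which the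
   coefficients are controlled by the L^2 norm ([coef_le_unit_integral]).

   A banded coercive matrix with bounded entries has an inverse with bounded
   column sums ([banded_inverse_col_sum]).  If x is the j-th column of the
   inverse and D = diag (i - j), then D kills the j-th basis vector, whence
   G D x = [G, D] x; the commutator [G, D] is again banded and bounded, so
   coercivity bounds |D x|_2 by |x|_2.  Thus the x_i are square summable with
   the weights 1 + (i - j)^2, hence summable. *)

(** * Integrals of piecewise polynomial functions *)

Section PolyIntegral.
Variable R : realType.
Implicit Types (q : {poly R}).

(** At [i = 0] the division by zero makes the constant coefficient vanish. *)
Definition primitive_poly q : {poly R} :=
  \poly_(i < (size q).+1) (q`_i.-1 / i%:R).

Lemma coef_primitive_poly q i : (primitive_poly q)`_i = q`_i.-1 / i%:R.
Proof.
rewrite coef_poly; case: ltnP => // hi.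
by rewrite nth_default ?mul0r //; case: i hi.
Qed.

Lemma primitive_poly_is_linear : linear primitive_poly.
Proof.
move=> a q r; apply/polyP => i.
by rewrite coefD coefZ !coef_primitive_poly coefD coefZ mulrDl mulrA.
Qed.

Lemma deriv_primitive_poly q : (primitive_poly q)^`() = q.
Proof.
apply/polyP => i; rewrite coef_deriv coef_primitive_poly /=.
by rewrite -[LHS]mulr_natr divfK // pnatr_eq0.
Qed.

Lemma primitive_poly0 q : (primitive_poly q).[0] = 0.
Proof. by rewrite horner_coef0 coef_primitive_poly invr0 mulr0. Qed.

(** The integral of [q] over [0, 1], as a linear form on coefficients: once the
    cells are rescaled, only such integrals remain. *)
Definition unit_integral q : R := (primitive_poly q).[1].

Lemma unit_integral_is_scalar : scalar unit_integral.
Proof.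
by move=> a q r; rewrite /unit_integral primitive_poly_is_linear hornerD hornerZ.
Qed.

HB.instance Definition _ :=
  GRing.isLinear.Build R {poly R} R _ unit_integral unit_integral_is_scalar.

Lemma unit_integralE n q : (size q <= n)%N ->
  unit_integral q = \sum_(k < n) q`_k / k.+1%:R.
Proof.
move=> hq; rewrite /unit_integral (@horner_coef_wide _ n.+1); last first.
  exact: leq_trans (size_poly _ _) _.
rewrite big_ord_recl coef_primitive_poly invr0 mulr0 mul0r add0r.
by apply: eq_bigr => i _; rewrite coef_primitive_poly expr1n mulr1.
Qed.

Lemma continuous_within_poly q (A : set R) : {within A, continuous (horner q)}.
Proof. by apply/continuous_subspaceT => x; exact: continuous_horner. Qed.

Lemma integral_poly_itv q (a b : R) : a < b ->
  \int[@lebesgue_measure R]_(t in `[a, b]) q^`().[t] = q.[b] - q.[a].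
Proof.
move=> ab; rewrite /Rintegral (@continuous_FTC2 _ _ (horner q)) //.
- exact: continuous_within_poly.
- split=> [x _| |]; first exact: derivable_horner.
  + by apply: cvg_at_right_filter; exact: continuous_horner.
  + by apply: cvg_at_left_filter; exact: continuous_horner.
- by move=> x _; rewrite -derivE.
Qed.

Lemma measurable_poly q (A : set R) : measurable_fun A (horner q).
Proof.
apply: (measurable_funS measurableT (@subsetT _ A)).
by apply: continuous_measurable_fun; exact: continuous_horner.
Qed.

(** The end points, where [f] is arbitrary, are negligible.  They have to be
    arbitrary because a spline need not be differentiable at a knot. *)
Lemma eq_poly_cell_integrable (f : R -> R) q (a b : R) :
  (forall t, a < t < b -> f t = q.[t]) ->
  (@lebesgue_measure R).-integrable `[a, b] (EFin \o f).
Proof.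
move=> fq.
have mfo : measurable_fun `]a, b[ f.
  apply: (eq_measurable_fun (horner q)); last exact: measurable_poly.
  by move=> t; rewrite inE /= in_itv /= => /fq ->.
have mf : measurable_fun `[a, b] f by exact: (measurable_fun_itv_cc mfo).
have iq : (@lebesgue_measure R).-integrable `[a, b] (EFin \o horner q).
  apply: continuous_compact_integrable; first exact: segment_compact.
  exact: continuous_within_poly.
apply/integrableP; split; first exact/measurable_EFinP.
have /integrableP[_] := iq.
congr (_ < _)%E.
under eq_integral do rewrite /=.
apply: (@eq_integral_itv_bounded _ a b (fun t => `|f t|) (fun t => `|q.[t]|)).
- by apply: measurableT_comp => //; exact: measurable_poly.
- exact: measurableT_comp.
- by move=> t; rewrite in_itv /= => /fq ->.
Qed.

Lemma eq_poly_cell_integral (f : R -> R) q (a b : R) : a < b ->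
  (forall t, a < t < b -> f t = q^`().[t]) ->
  \int[@lebesgue_measure R]_(t in `[a, b]) f t = q.[b] - q.[a].
Proof.
move=> ab fq; rewrite -integral_poly_itv //; congr fine.
apply: eq_integral_itv_bounded; last first.
- by move=> t; rewrite in_itv /= => /fq ->.
- exact: measurable_poly.
- apply: (eq_measurable_fun (horner q^`())); last exact: measurable_poly.
  by move=> t; rewrite inE /= in_itv /= => /fq ->.
Qed.

Section Cells.
Variables (h : R) (f : R -> R) (q : nat -> {poly R}).
Hypothesis h0 : 0 < h.

Let cell_eq m := forall t, m%:R * h < t < m.+1%:R * h ->
  f t = (q m).[t / h - m%:R].

Let u m : {poly R} := h^-1 *: 'X - m%:R%:P.

Let uE m t : (u m).[t] = t / h - m%:R.
Proof. by rewrite /u !hornerE mulrC. Qed.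

Let deriv_u m : (u m)^`() = h^-1%:P.
Proof. by rewrite /u derivB derivZ derivX derivC subr0 alg_polyC. Qed.

Lemma cell_integrable m : cell_eq m ->
  (@lebesgue_measure R).-integrable `[m%:R * h, m.+1%:R * h] (EFin \o f).
Proof.
move=> fq; apply: (@eq_poly_cell_integrable _ (q m \Po u m)) => t /fq ->.
by rewrite horner_comp uE.
Qed.

Lemma cell_integral m : cell_eq m ->
  \int[@lebesgue_measure R]_(t in `[m%:R * h, m.+1%:R * h]) f t =
  h * unit_integral (q m).
Proof.
move=> fq; have hn0 : h != 0 by rewrite gt_eqF.
rewrite (@eq_poly_cell_integral _ (h *: (primitive_poly (q m) \Po u m))).
- rewrite !hornerZ !horner_comp !uE -mulrBr !mulfK // subrr primitive_poly0 subr0.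
  by rewrite -natrB // subSnn.
- by rewrite ltr_pM2r // ltr_nat.
- move=> t /fq ->; rewrite derivZ deriv_comp deriv_primitive_poly deriv_u.
  by rewrite hornerZ hornerM hornerC horner_comp uE mulrCA mulfV // mulr1.
Qed.

(** Each cell is measured in its own variable [t / h - m], which runs over
    [0, 1], so that the mesh size only enters as a common factor. *)
Lemma cells_integral N : (forall m, (m < N)%N -> cell_eq m) ->
  (@lebesgue_measure R).-integrable `[0, N%:R * h] (EFin \o f) /\
  \int[@lebesgue_measure R]_(t in `[0, N%:R * h]) f t =
  h * \sum_(m < N) unit_integral (q m).
Proof.
elim: N => [_|N IHN fq].
  rewrite mul0r big_ord0 mulr0 set_itv1 Rintegral_set1; split=> //.
  apply/integrableP; split; first exact: measurable_fun_set1.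
  by rewrite integral_set1 ltry.
have [|IH1 IH2] := IHN; first by move=> m hm; apply: fq; exact: ltnW.
have le0 : 0 <= N%:R * h by rewrite mulr_ge0 // ltW.
have le1 : N%:R * h <= N.+1%:R * h by rewrite ler_pM2r // ler_nat.
have iN := cell_integrable (fq N (ltnSn N)).
have iNo : (@lebesgue_measure R).-integrable `]N%:R * h, N.+1%:R * h] (EFin \o f).
  by apply: integrableS iN => //; apply: subset_itvr; rewrite bnd_simp.
have splitU : `[0, N.+1%:R * h]%classic =
    `[0, N%:R * h]%classic `|` `]N%:R * h, N.+1%:R * h]%classic.
  by rewrite -itv_bndbnd_setU ?bnd_simp.
have dis : [disjoint `[0, N%:R * h]%classic & `]N%:R * h, N.+1%:R * h]%classic].
  apply/disj_setPS => y [/=]; rewrite 2!in_itv /= => /andP[_ yx] /andP[].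
  by rewrite ltNge yx.
have iN1 : (@lebesgue_measure R).-integrable `[0, N.+1%:R * h] (EFin \o f).
  rewrite splitU; have [m1 f1] := integrableP _ _ _ IH1.
  have [m2 f2] := integrableP _ _ _ iNo.
  have mU : measurable_fun (`[0, N%:R * h] `|` `]N%:R * h, N.+1%:R * h]) (EFin \o f).
    exact/measurable_funU.
  apply/integrableP; split => //.
  rewrite ge0_integral_setU //; first exact: lte_add_pinfty.
  exact: measurableT_comp.
split=> //; rewrite {1}splitU Rintegral_setU // -?splitU //.
rewrite IH2 Rintegral_itv_obnd_cbnd // cell_integral; last exact: fq.
by rewrite big_ord_recr /= mulrDr.
Qed.

End Cells.
End PolyIntegral.

(** * The L^2 norm controls the coefficients of a polynomial *)

Section PolyNorm.
Variable R : realType.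
Implicit Types (q : {poly R}).

(** The primitive of [q * q] is nondecreasing on [0, 1].  Without an increase
    between 0 and 1 it would vanish on [0, 1], hence have infinitely many roots,
    and its derivative [q * q] would be zero. *)
Lemma unit_integral_sqr_gt0 q : q != 0 -> 0 < unit_integral (q * q).
Proof.
move=> qn0; rewrite ltNge; apply/negP => Ile0.
set Q := primitive_poly (q * q).
have Qmono : {in `[0, 1]%R &, {homo horner Q : x y / x <= y >-> x <= y}}.
  apply: ger0_derive1_le_cc.
  - by move=> x _; exact: derivable_horner.
  - by move=> x _; rewrite -derivE deriv_primitive_poly hornerM -expr2 sqr_ge0.
  - exact: continuous_within_poly.
have Q0 x : 0 <= x <= 1 -> root Q x.
  move=> /andP[x0 x1]; rewrite rootE eq_le; apply/andP; split.
    apply: le_trans Ile0.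
    by apply: Qmono => //; rewrite in_itv /= ?x0 ?x1 ?ler01 ?lexx.
  rewrite -[leLHS](primitive_poly0 (q * q)).
  by apply: Qmono => //; rewrite in_itv /= ?x0 ?x1 ?ler01 ?lexx.
have Qeq0 : Q = 0.
  (* The points 1, 1/2, 1/3, ... provide more roots than the degree. *)
  apply: (@roots_geq_poly_eq0 _ _ [seq i.+1%:R^-1 | i <- iota 0 (size Q)]).
  - apply/allP => _ /mapP[i _ ->]; apply: Q0.
    by rewrite invr_ge0 ler0n invf_le1 ?ler1n ?ltr0n.
  - rewrite map_inj_uniq ?iota_uniq // => i j /invr_inj /eqP.
    by rewrite eqr_nat => /eqP[].
  - by rewrite size_map size_iota.
have := deriv_primitive_poly (q * q); rewrite -/Q Qeq0 deriv0 => /esym/eqP.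
by rewrite mulf_eq0 orbb (negPf qn0).
Qed.

Lemma unit_integral_sqr_ge0 q : 0 <= unit_integral (q * q).
Proof.
have [->|/unit_integral_sqr_gt0/ltW //] := eqVneq q 0.
by rewrite mul0r linear0.
Qed.

(** Extracting a coefficient is a linear form on polynomials of bounded degree,
    and it is represented by a polynomial because the Gram matrix of the
    monomials (the Hilbert matrix) is invertible, by positivity. *)
Lemma unit_integral_dual n : exists z : 'I_n -> {poly R},
  forall k q, (size q <= n)%N -> unit_integral (z k * q) = q`_k.
Proof.
pose H : 'M[R]_n := \matrix_(i, j) unit_integral ('X^i * 'X^j).
have HE (v : 'rV[R]_n) q : (size q <= n)%N ->
    unit_integral (rVpoly v * q) = \sum_(j < n) (v *m H) 0 j * q`_j.
  move=> hq; have {1}-> : q = \sum_(j < n) q`_j *: 'X^j.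
    apply/polyP => k; rewrite -poly_def coef_poly; case: ltnP => // hk.
    by rewrite nth_default // (leq_trans hq).
  rewrite mulr_sumr linear_sum; apply: eq_bigr => j _.
  rewrite -scalerAr linearZ /= mulrC; congr (_ * _).
  rewrite /rVpoly poly_def mulr_suml linear_sum mxE; apply: eq_bigr => i _.
  rewrite -scalerAl linearZ /= mxE insubT //= => ?.
  by congr (v _ _ * _); exact/val_inj.
have Hfree : row_free H.
  apply: inj_row_free => v vH0.
  have [v0|/unit_integral_sqr_gt0] := eqVneq (rVpoly v) 0.
    by rewrite -(rVpolyK v) v0 linear0.
  rewrite HE ?size_poly // vH0 big1 ?ltxx // => j _.
  by rewrite mxE mul0r.
have Hunit : H \in unitmx by rewrite -row_free_unit.
exists (fun k => rVpoly (row k (invmx H))) => k q hq.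
rewrite HE // -row_mul mulVmx // (bigD1 k) //= big1 ?addr0.
  by rewrite !mxE eqxx mul1r.
by move=> j /negPf jk; rewrite !mxE eq_sym jk mul0r.
Qed.

(** This is the Cauchy-Schwarz inequality for [q] and the polynomial that
    represents the [k]-th coefficient. *)
Lemma coef_le_unit_integral n : exists2 C : R, 0 < C &
  forall q k, (size q <= n)%N -> q`_k ^+ 2 <= C * unit_integral (q * q).
Proof.
have [z zE] := unit_integral_dual n.
pose C := 1 + \sum_(k < n) unit_integral (z k * z k).
have C1 : 1 <= C by rewrite lerDl sumr_ge0 // => k _; exact: unit_integral_sqr_ge0.
exists C => [|q k hq]; first exact: lt_le_trans C1.
have [nk|kn] := leqP n k.
  rewrite nth_default ?expr0n; last exact: leq_trans nk.
  by rewrite mulr_ge0 ?unit_integral_sqr_ge0 // (le_trans _ C1).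
pose i := Ordinal kn; set s := unit_integral (q * q).
have s0 : 0 <= s by exact: unit_integral_sqr_ge0.
have ZC : unit_integral (z i * z i) <= C.
  rewrite /C (bigD1 i) //= addrCA lerDl addr_ge0 // sumr_ge0 // => j _.
  exact: unit_integral_sqr_ge0.
set Z := unit_integral (z i * z i) in ZC *.
have Z0 : 0 <= Z by exact: unit_integral_sqr_ge0.
have quad (a b : R) : 0 <= a ^+ 2 * s - a * b * q`_k *+ 2 + b ^+ 2 * Z.
  have := unit_integral_sqr_ge0 (a *: q - b *: z i).
  have -> : (a *: q - b *: z i) * (a *: q - b *: z i) =
     a ^+ 2 *: (q * q) - (a * b *+ 2) *: (z i * q) + b ^+ 2 *: (z i * z i).
    by rewrite -!mul_polyC; ring.
  rewrite linearD linearB !linearZ /= zE // -/s -/Z.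
  by congr (0 <= _); rewrite /GRing.scale /=; ring.
(* These are the weights that minimize the square, with C in place of Z. *)
have := quad C q`_k.
have C0 : 0 < C by exact: lt_le_trans C1.
have : q`_k ^+ 2 * Z <= q`_k ^+ 2 * C by rewrite ler_wpM2l // sqr_ge0.
move=> h1 h2; rewrite -(ler_pM2l C0); nra.
Qed.

End PolyNorm.

(** * B-splines on one mesh cell *)

Section Pieces.
Variable R : realType.
Variables (N p : nat).

Definition knot_index (i : nat) : nat := minn (i - p) N.

Definition knot_gap (d i : nat) : R :=
  (knot_index (i + d))%:R - (knot_index i)%:R.

(** The polynomial that the B-spline of degree [d] and index [i] coincides with
    on the [m]-th cell, in the variable [t / h - m].  Knots are measured in units
    of [h], which removes [T] from the recursion. *)
Fixpoint piece (m d i : nat) {struct d} : {poly R} :=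
  match d with
  | 0 => (i == m + p)%N%:R
  | d'.+1 =>
      (knot_gap d i)^-1 *: (('X + (m%:R - (knot_index i)%:R)%:P) * piece m d' i) +
      (knot_gap d i.+1)^-1 *:
        (((knot_index (i.+1 + d))%:R - m%:R)%:P - 'X) * piece m d' i.+1
  end.

Lemma pieceS m d i : piece m d.+1 i =
  (knot_gap d.+1 i)^-1 *: (('X + (m%:R - (knot_index i)%:R)%:P) * piece m d i) +
  (knot_gap d.+1 i.+1)^-1 *:
    ((((knot_index (i + d.+2))%:R - m%:R)%:P - 'X) * piece m d i.+1).
Proof. by rewrite /= -scalerAl addSnnS. Qed.

Lemma knot_gap_nat d i :
  knot_gap d i = (knot_index (i + d) - knot_index i)%:R.
Proof. by rewrite natrB // /knot_index; lia. Qed.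

Lemma knot_gap_ge0 d i : 0 <= knot_gap d i.
Proof. by rewrite knot_gap_nat. Qed.

Lemma knot_gap_le d i : knot_gap d i <= d%:R.
Proof. by rewrite knot_gap_nat ler_nat /knot_index; lia. Qed.

(** Knots being integers, a nonzero gap is at least 1. *)
Lemma knot_gap_inv_le1 d i : (knot_gap d i)^-1 <= 1.
Proof.
rewrite knot_gap_nat; case: (_ - _)%N => [|n]; first by rewrite invr0 ler01.
by rewrite invf_le1 ?ler1n ?ltr0n.
Qed.

Lemma piece_notin m d i : ~~ (i <= m + p <= i + d)%N -> piece m d i = 0.
Proof.
elim: d i => [|d IHd] i hi /=.
  by case: eqP => // him; move: hi; rewrite him; lia.
by rewrite !IHd ?mulr0 ?scaler0 ?addr0 //; lia.
Qed.

Lemma size_piece m d i : (size (piece m d i) <= d.+1)%N.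
Proof.
elim: d i => [|d IHd] i /=.
  by case: eqP => _; rewrite ?size_poly1 ?size_poly0.
rewrite (leq_trans (size_polyD _ _)) // geq_max; apply/andP; split.
  rewrite (leq_trans (size_scale_leq _ _)) // (leq_trans (size_polyMleq _ _)) //.
  by rewrite size_XaddC; have := IHd i; lia.
rewrite (leq_trans (size_polyMleq _ _)) //.
have : (size ((knot_gap d.+1 i.+1)^-1 *:
    (((knot_index (i.+1 + d.+1))%:R - m%:R)%:P - 'X) : {poly R}) <= 2)%N.
  by rewrite (leq_trans (size_scale_leq _ _)) // -opprB size_polyN size_XsubC.
by have := IHd i.+1; lia.
Qed.

(** The ratios of the recursion are invariant under scaling by [h], and in
    degree 0 only the index [m + p] selects the cell [m]. *)
Lemma cox_de_boor_piece (T t : R) m d i : 0 < T -> (m < N)%N ->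
  m%:R * mesh_size T N < t < m.+1%:R * mesh_size T N ->
  cox_de_boor T N p d i t = (piece m d i).[t / mesh_size T N - m%:R].
Proof.
move=> T0 mN; set h := mesh_size T N => /andP[mt tm].
have h0 : 0 < h by rewrite divr_gt0 // ltr0n; lia.
have hn0 : h != 0 by rewrite gt_eqF.
have knotE j : knot T N p j = (knot_index j)%:R * h by [].
have ltk (k : nat) : (k%:R * h <= t) = (k <= m)%N.
  apply/idP/idP => [kt|km].
    have := le_lt_trans kt tm; rewrite ltr_pM2r // ltr_nat; lia.
  by apply: le_trans (ltW mt); rewrite ler_pM2r // ler_nat.
have gtk (k : nat) : (t < k%:R * h) = (m < k)%N by rewrite ltNge ltk -ltnNge.
elim: d i => [|d IHd] i.
  rewrite /= !knotE ltk gtk.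
  have -> : (t == (knot_index i.+1)%:R * h) = false.
    by apply/eqP => tk; move: mt tm; rewrite tk !ltr_pM2r // !ltr_nat; lia.
  rewrite andbF orbF.
  have -> : (knot_index i <= m < knot_index i.+1)%N = (i == (m + p)%N).
    by rewrite /knot_index; lia.
  by case: eqP => _; rewrite ?hornerC ?horner0.
have st : t = (t / h) * h by rewrite divfK.
have ratio (a b c e : R) : (a * h - b * h) / (c * h - e * h) = (a - b) / (c - e).
  by rewrite -!mulrBl -mulf_div divff // mulr1.
rewrite [cox_de_boor _ _ _ _ _ _]/= !IHd !knotE {1 3}st !ratio.
rewrite pieceS !(hornerD, hornerN, hornerZ, hornerM, hornerX, hornerC).
by rewrite /knot_gap addSn !addnS; ring.
Qed.

(** By induction on the degree: the derivatives of the two lower degree pieces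
    expand into three pieces of two degrees less.  The terms in the outer two
    cancel at once; the middle one is left with the coefficient in [key]. *)
Lemma deriv_piece m d i : (piece m d.+1 i)^`() =
  d.+1%:R *: ((knot_gap d.+1 i)^-1 *: piece m d i -
              (knot_gap d.+1 i.+1)^-1 *: piece m d i.+1).
Proof.
elim: d i => [|d IHd] i.
  have deriv0 j : (piece m 0 j)^`() = 0.
    by rewrite /=; case: eqP => _; rewrite /= ?derivC // raddf0.
  rewrite pieceS derivD !derivZ !derivM !deriv0 !mulr0 !addr0 derivD derivB.
  by rewrite derivX !derivC -!mul_polyC; ring.
(* Both products equal 1 unless a gap of [d.+2] steps vanishes; the gap of
   [d.+1] steps lies inside both of them, so it then vanishes too. *)
have key : (knot_gap d.+1 i.+1)^-1 *
    ((knot_gap d.+2 i.+1)^-1 * knot_gap d.+2 i.+1 -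
     (knot_gap d.+2 i)^-1 * knot_gap d.+2 i) = 0.
  have [->|g0] := eqVneq (knot_gap d.+1 i.+1) 0; first by rewrite invr0 mul0r.
  have g1 : knot_gap d.+2 i != 0.
    by move: g0; rewrite !knot_gap_nat !pnatr_eq0 /knot_index; lia.
  have g2 : knot_gap d.+2 i.+1 != 0.
    by move: g0; rewrite !knot_gap_nat !pnatr_eq0 /knot_index; lia.
  by rewrite !mulVf // subrr mulr0.
rewrite pieceS derivD !derivZ !derivM !IHd !pieceS derivD derivB derivX !derivC.
rewrite -!mul_polyC.
apply/eqP; rewrite -subr_eq0; apply/eqP.
transitivity (d.+1%:R * ((knot_gap d.+1 i.+1)^-1 *
    ((knot_gap d.+2 i.+1)^-1 * knot_gap d.+2 i.+1 -
     (knot_gap d.+2 i)^-1 * knot_gap d.+2 i))%:P * piece m d i.+1); last first.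
  by rewrite key mulr0 mul0r.
set G1 := (_^-1); set G2 := (knot_gap d.+2 i.+1)^-1; set G3 := (knot_gap d.+2 i)^-1.
rewrite /knot_gap !addSn !addnS.
ring.
Qed.

(** Partition of unity.  After a shift of the index, the piece of index [i] gets
    the weight [knot_gap / knot_gap]; this is 1 for the pieces that are active on
    the cell, and the others vanish. *)
Lemma sum_piece M m d : (d <= p)%N -> (m < N)%N -> (m + p < M)%N ->
  \sum_(i < M) piece m d i = 1.
Proof.
move=> dp mN mM; elim: d dp => [_|d IHd dp].
  rewrite (bigD1 (Ordinal mM)) //= eqxx big1 ?addr0 // => i.
  by rewrite -val_eqE /= => /negPf ->.
pose B i := (knot_gap d.+1 i)^-1 *:
    ((((knot_index (i + d.+1))%:R - m%:R)%:P - 'X) * piece m d i).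
have shiftB : \sum_(i < M) B i.+1 = \sum_(i < M) B i.
  have := erefl (\sum_(i < M.+1) B i).
  rewrite {1}big_ord_recl big_ord_recr /=.
  have -> : B 0 = 0 by rewrite /B piece_notin ?mulr0 ?scaler0 //; lia.
  by rewrite [B M]/B piece_notin ?mulr0 ?scaler0 ?add0r ?addr0 //; lia.
rewrite -[RHS](IHd (ltnW dp)).
under eq_bigr do rewrite pieceS.
rewrite big_split /=.
under [X in _ + X]eq_bigr => i _ do rewrite -[(i + d.+2)%N]addSnnS -/(B i.+1).
rewrite shiftB -big_split /=; apply: eq_bigr => i _.
have [act|nact] := boolP (i <= m + p <= i + d)%N; last first.
  by rewrite /B !piece_notin // !mulr0 !scaler0 addr0.
have g0 : knot_gap d.+1 i != 0.
  by rewrite knot_gap_nat pnatr_eq0 /knot_index; lia.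
rewrite /B -scalerDr -mulrDl.
have -> : 'X + (m%:R - (knot_index i)%:R)%:P +
    (((knot_index (i + d.+1))%:R - m%:R)%:P - 'X) = (knot_gap d.+1 i)%:P.
  by rewrite /knot_gap; ring.
by rewrite mul_polyC scalerA mulVf // scale1r.
Qed.

(** The knots of a piece that does not vanish on the cell lie within distance
    [d + 1] of it, and inverse gaps are at most 1, so the recursion multiplies
    coefficients by a bounded factor. *)
Lemma coef_piece_le m d i k : (m < N)%N ->
  `|(piece m d i)`_k| <= (2 ^ d * d.+1`!)%:R.
Proof.
move=> mN; elim: d i k => [|d IHd] i k.
  rewrite /=; case: eqP => _; rewrite ?coef0 ?normr0 ?ler0n //.
  by rewrite coef1; case: eqP => _; rewrite ?normr1 ?normr0 ?ler01.
set K : R := (2 ^ d * d.+1`!)%:R in IHd.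
have K0 : 0 <= K by exact: ler0n.
have coefX1 j : `|('X * piece m d j)`_k| <= K.
  by rewrite coefXM; case: eqP => _; rewrite ?normr0.
have bound (a : R) j (x y : R) : 0 <= x <= 1 -> `|y| <= K ->
    (piece m d j != 0 -> `|a| <= d.+1%:R) ->
  `|x * (y + a * (piece m d j)`_k)| <= d.+2%:R * K.
  move=> /andP[x0 x1] yK aK; rewrite normrM ger0_norm //.
  apply: le_trans (ler_piMl (normr_ge0 _) x1) _.
  apply: le_trans (ler_normD _ _) _.
  rewrite -addn1 natrD mulrDl mul1r addrC lerD //.
  rewrite normrM; have [->|/aK aK'] := eqVneq (piece m d j) 0.
    by rewrite coef0 normr0 mulr0 mulr_ge0.
  by rewrite ler_pM.
have inv01 j : 0 <= (knot_gap d.+1 j)^-1 <= 1.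
  by rewrite invr_ge0 knot_gap_ge0 knot_gap_inv_le1.
have natB_le (a b c : nat) : (a <= b + c)%N -> (b <= a + c)%N ->
    `|a%:R - b%:R : R| <= c%:R.
  by move=> h1 h2; rewrite ler_norml lerBrDr lerBlDr addrC -!natrD lerBlDr -natrD
    !ler_nat; lia.
rewrite pieceS !mulrDl mulNr coefD !coefZ !coefD coefN !coefCM.
apply: le_trans (ler_normD _ _) _.
have -> : (2 ^ d.+1 * d.+2`!)%:R = d.+2%:R * K + d.+2%:R * K.
  rewrite -mulrDl -natrD -natrM; congr (_%:R).
  by rewrite expnS [(d.+2)`!]factS; lia.
apply: lerD; first apply: bound => //.
  move=> pn0; apply: natB_le; apply: contraNT pn0 => hn; rewrite piece_notin //;
    move: hn; rewrite /knot_index; lia.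
rewrite [_ * _ - _]addrC; apply: bound => //; first by rewrite normrN.
move=> pn0; apply: natB_le; apply: contraNT pn0 => hn; rewrite piece_notin //;
    move: hn; rewrite /knot_index; lia.
Qed.

End Pieces.

(** * Local stability of the B-spline basis *)

Section Window.
Variable R : realType.

Lemma ler_sum_window n a w (F : nat -> R) B : 0 <= B ->
  (forall i, (a <= i < a + w)%N -> `|F i| <= B) ->
  (forall i, ~~ (a <= i < a + w)%N -> F i = 0) ->
  \sum_(i < n) `|F i| <= w%:R * B.
Proof.
move=> B0 Fle F0.
rewrite -(big_mkord xpredT (fun i => `|F i|)).
have le1 : \sum_(0 <= i < n) `|F i| <= \sum_(0 <= i < n + (a + w)) `|F i|.
  by rewrite [leRHS](big_cat_nat (n := n)) ?leq_addr //= lerDl sumr_ge0.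
apply: le_trans le1 _.
rewrite (big_cat_nat (n := a)) /= ?leq0n //; last lia.
rewrite big_nat_cond big1 ?add0r; last first.
  by move=> i hi; rewrite F0 ?normr0 //; lia.
rewrite (big_cat_nat (n := a + w)) /= ?leq_addr //; last lia.
rewrite [X in _ + X]big_nat_cond [X in _ + X]big1 ?addr0; last first.
  by move=> i hi; rewrite F0 ?normr0 //; lia.
apply: le_trans (_ : \sum_(a <= i < a + w) B <= _).
  rewrite big_nat_cond [leRHS]big_nat_cond; apply: ler_sum => i hi.
  by apply: Fle; lia.
by rewrite sumr_const_nat addKn mulr_natl.
Qed.

End Window.

Section Stability.
Variable R : realType.

(** Summation by parts: the spline of degree [d] that is the derivative has the
    scaled differences of [c] as coefficients.  At the index 0, where [c i.-1] is
    [c 0], the piece vanishes because [d < p]. *)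
Lemma deriv_sum_piece N p m d M (c : nat -> R) :
  (d < p)%N -> (m < N)%N -> (m + p < M)%N ->
  (\sum_(i < M) c i *: piece R N p m d.+1 i)^`() =
  \sum_(i < M) (d.+1%:R * (knot_gap R N p d.+1 i)^-1 * (c i - c i.-1)) *:
    piece R N p m d i.
Proof.
move=> dp mN mM.
pose F i := (d.+1%:R * (knot_gap R N p d.+1 i)^-1 * c i.-1) *: piece R N p m d i.
have shiftF : \sum_(i < M) F i.+1 = \sum_(i < M) F i.
  have := erefl (\sum_(i < M.+1) F i).
  rewrite {1}big_ord_recl big_ord_recr /=.
  have -> : F 0 = 0 by rewrite /F piece_notin ?scaler0 //; lia.
  by rewrite [F M]/F piece_notin ?scaler0 ?add0r ?addr0 //; lia.
rewrite raddf_sum /=.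
under eq_bigr => i _ do rewrite derivZ deriv_piece.
transitivity (\sum_(i < M) (d.+1%:R * (knot_gap R N p d.+1 i)^-1 * c i) *:
    piece R N p m d i - \sum_(i < M) F i.+1).
  by rewrite -sumrB; apply: eq_bigr => i _; rewrite /F -!mul_polyC /=; ring.
by rewrite shiftF -sumrB; apply: eq_bigr => i _; rewrite /F -!mul_polyC; ring.
Qed.

Lemma dist_steps (c : nat -> R) (D : R) lo hi :
  (forall i, (lo < i <= hi)%N -> `|c i - c i.-1| <= D) ->
  forall i j, (lo <= i <= hi)%N -> (lo <= j <= hi)%N ->
  `|c i - c j| <= (hi - lo)%:R * D.
Proof.
move=> step.
have up j e : (lo <= j)%N -> (j + e <= hi)%N -> `|c (j + e)%N - c j| <= e%:R * D.
  move=> loj; elim: e => [_|e IHe ehi]; first by rewrite addn0 subrr normr0 mul0r.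
  rewrite addnS -[X in `|X|](subrKA (c (j + e)%N)) (le_trans (ler_normD _ _)) //.
  rewrite -natr1 mulrDl mul1r addrC lerD ?IHe //; first lia.
  by apply: (step (j + e).+1); lia.
move=> i j hi1 hj1.
wlog ij : i j hi1 hj1 / (j <= i)%N.
  by move=> wl; case/orP: (leq_total i j) => ij; [rewrite distrC|]; apply: wl.
have hj : (lo <= j)%N by lia.
have hi' : (j + (i - j) <= hi)%N by lia.
have := up j (i - j)%N hj hi'; rewrite subnKC // => /le_trans; apply.
have [->|ineqj] := eqVneq i j.
  have [->|hl] := eqVneq hi lo; first by rewrite !subnn.
  rewrite subnn mul0r mulr_ge0 //.
  by apply: le_trans (normr_ge0 _) (step hi _); lia.
apply: ler_wpM2r; last by rewrite ler_nat; lia.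
by apply: le_trans (normr_ge0 _) (step i _); lia.
Qed.

(** The coefficients of the polynomial stand for its norm, and they are compared
    with the coefficients in the B-spline basis.  By [deriv_sum_piece] and the
    induction hypothesis, consecutive active coefficients differ by a bounded
    amount, since the scaling factor is at least 1.  So all of them differ from
    [c i] by a bounded amount, and by the partition of unity this bounds the
    difference between [c i] and the value of [f] at 0. *)
Lemma piece_stable d : exists2 C : R, 0 < C &
  forall N p m M (c : nat -> R) A,
  (d <= p)%N -> (m < N)%N -> (m + p < M)%N ->
  (forall k, `|(\sum_(i < M) c i *: piece R N p m d i)`_k| <= A) ->
  forall i, (i <= m + p <= i + d)%N -> `|c i| <= C * A.
Proof.
elim: d => [|d [C C0 IHd]].
  exists 1 => // N p m M c A _ mN mM cA i hi.
  have -> : i = (m + p)%N by lia.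
  have := cA 0; rewrite mul1r (bigD1 (Ordinal mM)) //= eqxx big1.
    by rewrite addr0 coefZ coef1 mulr1.
  by move=> j; rewrite -val_eqE /= => /negPf ->; rewrite scaler0.
pose K : R := (2 ^ d.+1 * d.+2`!)%:R.
have K0 : 0 <= K by exact: ler0n.
exists (1 + d.+2%:R * (d.+1%:R * (C * d.+1%:R) * K)).
  by rewrite ltr_pwDl // !mulr_ge0 // ltW.
move=> N p m M c A dp mN mM cA.
set f := \sum_(i < M) _ in cA.
have A0 : 0 <= A by exact: le_trans (normr_ge0 _) (cA 0).
have size_f : (size f <= d.+2)%N.
  apply: leq_trans (size_sum _ _ _) _; apply/bigmax_leqP => i _.
  by apply: leq_trans (size_scale_leq _ _) (size_piece _ _ _ _ _ _).
have dfA k : `|(f^`())`_k| <= d.+1%:R * A.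
  rewrite coef_deriv -[X in `|X|]mulr_natl normrM ger0_norm ?ler0n //.
  have [kd|dk] := leqP k.+1 d.+1; first by rewrite ler_pM ?ler_nat.
  by rewrite (nth_default _ (leq_trans size_f dk)) normr0 mulr0 mulr_ge0.
have stepc i : (m + p - d.+1 < i <= m + p)%N ->
    `|c i - c i.-1| <= C * d.+1%:R * A.
  move=> hi; rewrite -mulrA.
  pose b j := d.+1%:R * (knot_gap R N p d.+1 j)^-1 * (c j - c j.-1).
  have : `|b i| <= C * (d.+1%:R * A).
    apply: (IHd N p m M b) => //; [lia| |lia].
    by move=> k; rewrite -deriv_sum_piece.
  move=> /(le_trans _); apply; rewrite /b normrM ler_peMl ?normr_ge0 //.
  have gpos : 0 < knot_gap R N p d.+1 i.
    by rewrite knot_gap_nat ltr0n /knot_index; lia.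
  rewrite ger0_norm ?mulr_ge0 ?invr_ge0 ?(ltW gpos) //.
  by rewrite ler_pdivlMr // mul1r knot_gap_le.
set D := C * d.+1%:R * A in stepc.
have D0 : 0 <= D by rewrite !mulr_ge0 // ltW.
move=> i hi.
have dist j : (j <= m + p <= j + d.+1)%N -> `|c j - c i| <= d.+1%:R * D.
  move=> hj; have := dist_steps stepc (i := j) (j := i).
  by rewrite subKn; [apply; lia | lia].
have ci : c i%N = f`_0 - \sum_(j < M) (c j - c i) * (piece R N p m d.+1 j)`_0.
  have -> : \sum_(j < M) (c j - c i) * (piece R N p m d.+1 j)`_0 =
      f`_0 - c i * (\sum_(j < M) piece R N p m d.+1 j)`_0.
    rewrite /f !coef_sum mulr_sumr -sumrB; apply: eq_bigr => j _.
    by rewrite coefZ mulrBl.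
  by rewrite sum_piece // coef1 mulr1; ring.
rewrite ci (le_trans (ler_normB _ _)) // mulrDl mul1r lerD //.
apply: le_trans (ler_norm_sum _ _ _) _.
apply: le_trans (_ : d.+2%:R * (d.+1%:R * D * K) <= _); last first.
  by rewrite le_eqVlt; apply/orP; left; apply/eqP; rewrite /D; ring.
apply: (@ler_sum_window _ M (m + p - d.+1) d.+2
  (fun j => (c j - c i) * (piece R N p m d.+1 j)`_0)).
- by apply: mulr_ge0 => //; apply: mulr_ge0.
- move=> j hj; rewrite normrM ler_pM ?normr_ge0 ?coef_piece_le //.
  by apply: dist; lia.
- by move=> j hj; rewrite piece_notin ?coef0 ?mulr0 //; lia.
Qed.
End Stability.

(** * Inverses of coercive banded matrices *)

Section CoerciveBanded.
Variable R : realType.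

(** The Schur test with a free weight [e], chosen later so that the term in [y]
    is absorbed by coercivity. *)
Lemma schur_bound n (H : 'I_n -> 'I_n -> R) (r e : R) (x y : 'I_n -> R) : 0 < e ->
  (forall i, \sum_(k < n) `|H i k| <= r) ->
  (forall k, \sum_(i < n) `|H i k| <= r) ->
  \sum_(i < n) \sum_(k < n) y i * H i k * x k <=
  r / 2 * (e * \sum_(i < n) y i ^+ 2 + e^-1 * \sum_(i < n) x i ^+ 2).
Proof.
move=> e0 rowH colH.
have amgm (u v w : R) : u * w * v <= `|w| * (e * u ^+ 2 + e^-1 * v ^+ 2) / 2.
  apply: le_trans (ler_norm _) _; rewrite !normrM.
  rewrite -[u ^+ 2]real_normK ?num_real // -[v ^+ 2]real_normK ?num_real //.
  have := sqr_ge0 (e * `|u| - `|v|).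
  have -> : `|u| * `|w| * `|v| = `|w| * (`|u| * `|v|) by ring.
  rewrite -mulrA => h; apply: ler_wpM2l => //.
  rewrite -(ler_pM2l e0) !mulrA mulrDr !mulrA mulfV ?gt_eqF // mul1r.
  by rewrite ler_pdivlMr //; nra.
apply: le_trans (_ : \sum_(i < n) \sum_(k < n)
    (`|H i k| * (e * y i ^+ 2 + e^-1 * x k ^+ 2) / 2) <= _).
  by apply: ler_sum => i _; apply: ler_sum => k _; exact: amgm.
have -> : \sum_(i < n) \sum_(k < n)
    (`|H i k| * (e * y i ^+ 2 + e^-1 * x k ^+ 2) / 2) =
  \sum_(i < n) (e / 2 * y i ^+ 2) * (\sum_(k < n) `|H i k|) +
  \sum_(k < n) (e^-1 / 2 * x k ^+ 2) * (\sum_(i < n) `|H i k|).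
  under [X in _ = X + _]eq_bigr do rewrite mulr_sumr.
  under [X in _ = _ + X]eq_bigr do rewrite mulr_sumr.
  rewrite [X in _ = _ + X]exchange_big -big_split /=; apply: eq_bigr => i _.
  by rewrite -big_split; apply: eq_bigr => k _ /=; ring.
rewrite mulrDr !mulr_sumr; apply: lerD; apply: ler_sum => i _.
  rewrite [leRHS](_ : _ = (e / 2 * y i ^+ 2) * r); last by ring.
  by apply: ler_wpM2l => //; rewrite mulr_ge0 ?sqr_ge0 // divr_ge0 // ltW.
rewrite [leRHS](_ : _ = (e^-1 / 2 * x i ^+ 2) * r); last by ring.
by apply: ler_wpM2l => //; rewrite mulr_ge0 ?sqr_ge0 // divr_ge0 // ltW // invr_gt0.
Qed.

(** The terms are dominated by the increments of the bounded function
    [4 t / (1 + |t|)] at integers, which telescope.  Integrality matters: no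
    interval [t, t + 1] contains 0 in its interior. *)
Lemma sum_inv_sqr_le n (j : nat) :
  \sum_(i < n) (1 + (i%:R - j%:R) ^+ 2)^-1 <= 8 :> R.
Proof.
pose psi (k : nat) : R := 4 * (k%:R - j%:R) / (1 + `|k%:R - j%:R|).
have psi4 k : `|psi k| <= 4.
  rewrite /psi normrM normfV [X in _ / X]ger0_norm ?addr_ge0 //.
  by rewrite ler_pdivrMr ?ltr_pwDl // normrM ger0_norm //; lra.
have tele : \sum_(0 <= i < n) (psi i.+1 - psi i) <= 8.
  rewrite telescope_sumr //.
  have := psi4 n; have := psi4 0; rewrite !ler_norml.
  by move=> /andP[? ?] /andP[? ?]; lra.
apply: le_trans tele; rewrite big_mkord; apply: ler_sum => i _.
rewrite /psi -[i.+1%:R]natr1; set t := i%:R - j%:R.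
have -> : i%:R + 1 - j%:R = t + 1 by rewrite /t; ring.
have sq : 0 < 1 + t ^+ 2 by rewrite ltr_pwDl // sqr_ge0.
have [t0|t1] : 0 <= t \/ t <= -1.
  case: (leqP j i) => [ji|ij]; first by left; rewrite subr_ge0 ler_nat.
  by right; rewrite /t lerBlDr addrC -lerBlDr opprK natr1 ler_nat.
- have t1 : 0 <= t + 1 by lra.
  rewrite (ger0_norm t0) (ger0_norm t1).
  have -> : 4 * (t + 1) / (1 + (t + 1)) - 4 * t / (1 + t) =
     4 / ((1 + t) * (2 + t)).
    by field; apply/andP; split; lra.
  by rewrite ler_pdivlMr ?mulr_gt0 //; [rewrite mulrC ler_pdivrMr //; nra | lra | lra].
- have t0 : t <= 0 by lra.
  have t2 : t + 1 <= 0 by lra.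
  rewrite (ler0_norm t0) (ler0_norm t2).
  have -> : 4 * (t + 1) / (1 - (t + 1)) - 4 * t / (1 - t) =
     4 / (- t * (1 - t)).
    by field; apply/and3P; split; lra.
  by rewrite ler_pdivlMr ?mulr_gt0 //; [rewrite mulrC ler_pdivrMr //; nra | lra | lra].
Qed.

Definition coercive n (c : R) (G : 'M[R]_n) := forall x : 'I_n -> R,
  c * \sum_(i < n) x i ^+ 2 <= \sum_(i < n) \sum_(k < n) x i * G i k * x k.

Definition banded n (w : nat) (G : 'M[R]_n) := forall i k : 'I_n,
  G i k != 0 -> (i < k + w)%N && (k < i + w)%N.

Lemma coercive_unitmx n c (G : 'M[R]_n) : 0 < c -> coercive c G -> G \in unitmx.
Proof.
move=> c0 coG; rewrite -row_free_unit; apply: inj_row_free => v vG0.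
have := coG (fun i => v 0 i).
have -> : \sum_(i < n) \sum_(k < n) v 0 i * G i k * v 0 k = 0.
  rewrite exchange_big big1 // => k _; rewrite -mulr_suml.
  by have /rowP/(_ k) := vG0; rewrite !mxE => ->; rewrite mul0r.
rewrite pmulr_rle0 // => v0; apply/rowP => i; rewrite mxE; apply/eqP.
rewrite -sqrf_eq0 eq_le sqr_ge0 andbT; apply: le_trans v0.
by rewrite (bigD1 i) //= lerDl sumr_ge0 // => k _; exact: sqr_ge0.
Qed.

Lemma band_row_sum n (w : nat) (B : R) (H : 'I_n -> 'I_n -> R) : 0 <= B ->
  (forall i k, `|H i k| <= B) ->
  (forall i k, H i k != 0 -> (i < k + w)%N && (k < i + w)%N) ->
  forall i, \sum_(k < n) `|H i k| <= (w + w)%:R * B.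
Proof.
move=> B0 HB band i.
pose F (k : nat) := if insub k is Some k' then H i k' else 0.
have FE (k : 'I_n) : H i k = F k by rewrite /F valK.
under eq_bigr do rewrite FE.
apply: (@ler_sum_window _ n (i - w)) => // k.
  by move=> _; rewrite /F; case: insubP => [k' _ _|_]; rewrite ?HB ?normr0.
rewrite /F; case: insubP => // k' _ <- /= hk; apply/eqP; apply: contraNT hk.
by move=> /band; lia.
Qed.

(** Writing [x] for the [j]-th column of the inverse and [y = D x] with
    [D = diag (i - j)], the identity [G D x = [G, D] x] holds because [D] kills
    the [j]-th basis vector.  Coercivity applied to [x] and to [y] bounds both
    in the Euclidean norm, independently of the dimension, and the weights
    [1 + (i - j)^2] turn this into a bound on the sum of the absolute values. *)
Lemma banded_inverse_col_sum (c K : R) (w : nat) : 0 < c -> 0 <= K ->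
  exists2 C : R, 0 <= C & forall n (G : 'M[R]_n),
  coercive c G -> banded w G -> (forall i k, `|G i k| <= K) ->
  forall j, \sum_(i < n) `|invmx G i j| <= C.
Proof.
move=> c0 K0; pose r : R := 1 + (w + w)%:R * (K * w%:R).
have r0 : 0 < r by rewrite ltr_pwDl // !mulr_ge0.
pose S0 : R := c ^- 2; have S00 : 0 <= S0 by rewrite invr_ge0 sqr_ge0.
pose Y0 : R := r ^+ 2 / c ^+ 2 * S0.
have Y00 : 0 <= Y0 by rewrite mulr_ge0 // divr_ge0 // sqr_ge0.
exists ((S0 + Y0 + 8) / 2); first by rewrite divr_ge0 // !addr_ge0.
move=> n G coG bandG GK j.
pose x i := invmx G i j.
have Gx i : \sum_(k < n) G i k * x k = (i == j)%:R.
  have /matrixP/(_ i j) := mulmxV (coercive_unitmx c0 coG).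
  by rewrite !mxE.
pose S := \sum_(i < n) x i ^+ 2.
have S_ge0 : 0 <= S by rewrite sumr_ge0 // => i _; exact: sqr_ge0.
have leS : S <= S0.
  have cS : c * S <= x j.
    apply: le_trans (coG x) _.
    under eq_bigr => i _.
      under eq_bigr do rewrite -mulrA.
      rewrite -mulr_sumr Gx; over.
    by rewrite (bigD1 j) //= eqxx mulr1 big1 ?addr0 // => i /negPf ->; rewrite mulr0.
  have xS : x j ^+ 2 <= S.
    by rewrite /S (bigD1 j) //= lerDl sumr_ge0 // => i _; exact: sqr_ge0.
  have cS0 : 0 <= c * S by rewrite mulr_ge0 // ltW.
  have : (c * S) ^+ 2 <= S by apply: le_trans xS; rewrite !expr2; apply: ler_pM.
  rewrite /S0 -div1r ler_pdivlMr ?exprn_gt0 //.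
  by have [->|Sn0] := eqVneq S 0; [lra | have : 0 < S by [rewrite lt_def Sn0]; nra].
pose t (i : 'I_n) : R := i%:R - j%:R.
pose y i := t i * x i.
(* [H] is the commutator [G, D]. *)
pose H i k := G i k * (k%:R - i%:R).
have commute : \sum_(i < n) \sum_(k < n) y i * G i k * y k =
    \sum_(i < n) \sum_(k < n) y i * H i k * x k.
  apply: eq_bigr => i _; apply/eqP; rewrite -subr_eq0 -sumrB; apply/eqP.
  transitivity (y i * t i * \sum_(k < n) G i k * x k).
    rewrite mulr_sumr; apply: eq_bigr => k _; rewrite /H /y /t; ring.
  rewrite Gx; case: eqP => [->|_]; last by rewrite mulr0.
  by rewrite /t subrr mulr0 mul0r.
pose Y := \sum_(i < n) y i ^+ 2.
have HB i k : `|H i k| <= K * w%:R.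
  have [G0|/bandG hik] := eqVneq (G i k) 0.
    by rewrite /H G0 mul0r normr0 mulr_ge0.
  rewrite /H normrM ler_pM // ler_norml lerBrDr lerBlDr addrC lerBlDr -!natrD.
  by rewrite !ler_nat; lia.
have Hband i k : H i k != 0 -> (i < k + w)%N && (k < i + w)%N.
  by move=> Hn0; apply: bandG; apply: contraNneq Hn0 => G0; rewrite /H G0 mul0r.
have leY : Y <= Y0.
  have Kw0 : 0 <= K * w%:R by rewrite mulr_ge0.
  have rowH i : \sum_(k < n) `|H i k| <= r.
    by apply: le_trans (band_row_sum Kw0 HB Hband i) _; rewrite lerDr.
  have colH k : \sum_(i < n) `|H i k| <= r.
    have := @band_row_sum n w (K * w%:R) (fun a b => H b a) Kw0 (fun a b => HB b a) _ k.
    move=> /(_ _)/le_trans -> //; last by rewrite lerDr.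
    by move=> a b /Hband; rewrite andbC.
  (* With this weight, the term in [Y] of the Schur bound is [c * Y / 2]. *)
  have e0 : 0 < c / r by exact: divr_gt0.
  have := le_trans (coG y) _; rewrite commute => /(_ _ (schur_bound x y e0 rowH colH)).
  rewrite -/Y -/S => main.
  have : Y <= r ^+ 2 / c ^+ 2 * S.
    rewrite mulrAC ler_pdivlMr ?exprn_gt0 //.
    have e1 : r / 2 * (c / r * Y + (c / r)^-1 * S) = c * Y / 2 + r ^+ 2 * S / c / 2.
      by field; rewrite !gt_eqF.
    rewrite e1 in main.
    have : c * Y / 2 <= r ^+ 2 * S / c / 2 by lra.
    rewrite ler_pM2r // ler_pdivlMr //; lra.
  by move=> /le_trans; apply; rewrite ler_wpM2l // divr_ge0 // sqr_ge0.
apply: le_trans (_ : (S + Y + 8) / 2 <= _); last by lra.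
apply: le_trans (_ : (S + Y + \sum_(i < n) (1 + t i ^+ 2)^-1) / 2 <= _); last first.
  by have := sum_inv_sqr_le n j; rewrite -/t; lra.
rewrite /S /Y -!big_split mulr_suml /=; apply: ler_sum => i _.
have a0 : 0 < 1 + t i ^+ 2 by rewrite ltr_pwDl // sqr_ge0.
(* Each term is an instance of 2 |x| <= a x^2 + 1 / a with a = 1 + t^2. *)
rewrite -/(x i) -(ler_pM2l a0) mulrA mulrDr mulfV ?gt_eqF // /y exprMn.
rewrite -[x i ^+ 2]real_normK ?num_real //.
have := sqr_ge0 ((1 + t i ^+ 2) * `|x i| - 1); rewrite ler_pdivlMr //; nra.
Qed.

End CoerciveBanded.

(** * Factorization of the matrix *)

Section Gram.
Variable R : realType.

(** A piece of the B-spline of degree [p - 1] divided by its integral in units of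
    [h].  At the degenerate indices [0] and [N + p] it is zero, as is the
    boundary term of the derivative there. *)
Definition scaled_piece (N p m i : nat) : {poly R} :=
  (p%:R * (knot_gap R N p p i)^-1) *: piece R N p m p.-1 i.

Definition gram_entry (N p a b : nat) : R :=
  \sum_(m < N) unit_integral (scaled_piece N p m a * scaled_piece N p m b).

Definition gram_mx (N p n : nat) : 'M[R]_n :=
  \matrix_(a, b) gram_entry N p a.+1 b.+1.

Definition difference_mx (n : nat) : 'M[R]_n :=
  \matrix_(a, b) ((a == b)%:R - (a == b.+1 :> nat)%:R).

Definition cumulative_mx (n : nat) : 'M[R]_n := \matrix_(a, b) (b <= a)%N%:R.

(** The indices of matrices start at 0 and those of the scaled B-splines that
    matter at 1, whence the shifts; the condition on [F] takes care of the index
    that falls outside the matrix. *)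
Lemma difference_mx_row n (l : 'I_n) (F : nat -> R) : F 0 = 0 ->
  \sum_(a < n) difference_mx n l a * F a.+1 = F l.+1 - F l.
Proof.
move=> F0; under eq_bigr do rewrite mxE mulrBl.
rewrite sumrB (bigD1 l) //= eqxx mul1r [X in _ + X - _]big1 ?addr0; last first.
  by move=> a /negPf al; rewrite eq_sym al mul0r.
congr (_ - _); case: l => -[|l] hl /=.
  by rewrite F0 big1 // => a _; rewrite mul0r.
rewrite (bigD1 (Ordinal (ltnW hl))) //= eqxx mul1r big1 ?addr0 // => a.
by rewrite -val_eqE /= eqSS eq_sym => /negPf ->; rewrite mul0r.
Qed.

Lemma difference_mx_col n (j : 'I_n) (F : nat -> R) : F n.+1 = 0 ->
  \sum_(b < n) F b.+1 * difference_mx n b j = F j.+1 - F j.+2.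
Proof.
move=> Fn; under eq_bigr do rewrite mxE mulrBr.
rewrite sumrB (bigD1 j) //= eqxx mulr1 [X in _ + X - _]big1 ?addr0; last first.
  by move=> a /negPf ->; rewrite mulr0.
congr (_ - _); have [jn|nj] := ltnP j.+1 n.
  rewrite (bigD1 (Ordinal jn)) //= eqxx mulr1 big1 ?addr0 // => a.
  by rewrite -val_eqE /= => /negPf ->; rewrite mulr0.
have jn : j.+1 = n by apply/eqP; rewrite eqn_leq nj ltn_ord.
rewrite jn Fn big1 // => a _.
by rewrite ltn_eqF ?mulr0.
Qed.

Lemma difference_cumulative n : difference_mx n *m cumulative_mx n = 1%:M.
Proof.
apply/matrixP => l j; rewrite !mxE.
have := difference_mx_row l (F := fun k => (j < k)%N%:R) (erefl _).
move=> E; transitivity (((j < l.+1)%N%:R - (j < l)%N%:R) : R).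
  by rewrite -E; apply: eq_bigr => a _; rewrite !mxE.
rewrite ltnS -val_eqE /= leq_eqVlt eq_sym.
by case: eqP => [->|_]; rewrite ?ltnn ?subr0 //= subrr.
Qed.

Lemma scaled_piece0 N p m : scaled_piece N p m 0 = 0.
Proof.
by rewrite /scaled_piece knot_gap_nat /knot_index add0n !sub0n subnn min0n subnn
  invr0 mulr0 scale0r.
Qed.

Lemma scaled_piece_last N p m i : (N + p <= i)%N -> scaled_piece N p m i = 0.
Proof.
move=> hi; rewrite /scaled_piece knot_gap_nat (_ : (_ - _)%N = 0).
  by rewrite invr0 mulr0 scale0r.
by rewrite /knot_index; lia.
Qed.

Lemma scaled_piece_notin N p m i : (0 < p)%N -> ~~ (m < i <= m + p)%N ->
  scaled_piece N p m i = 0.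
Proof.
by move=> p0 hi; rewrite /scaled_piece piece_notin ?scaler0 //; lia.
Qed.

Lemma deriv_piece_scaled N p m i : (0 < p)%N ->
  (piece R N p m p i)^`() = scaled_piece N p m i - scaled_piece N p m i.+1.
Proof.
by case: p => // p _; rewrite deriv_piece /scaled_piece scalerBr !scalerA.
Qed.

(** Derivatives are local, so inside a cell that of the B-spline is that of its
    polynomial piece. *)
Lemma derive_bspline (T t : R) N p m i : 0 < T -> (0 < p)%N -> (m < N)%N ->
  m%:R * mesh_size T N < t < m.+1%:R * mesh_size T N ->
  derive1 (bspline T N p i) t = (mesh_size T N)^-1 *
    (scaled_piece N p m i - scaled_piece N p m i.+1).[t / mesh_size T N - m%:R].
Proof.
move=> T0 p0 mN ht; set h := mesh_size T N in ht *.
pose q : {poly R} := piece R N p m p i \Po (h^-1 *: 'X - m%:R%:P).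
have qE s : q.[s] = (piece R N p m p i).[s / h - m%:R].
  by rewrite /q horner_comp !hornerE mulrC.
have -> : derive1 (bspline T N p i) t = derive1 (horner q) t.
  rewrite !derive1E; apply: near_eq_derive.
  have : t \in `]m%:R * h, m.+1%:R * h[ by rewrite in_itv.
  move=> /near_in_itvoo; apply: filterS => s.
  rewrite in_itv /= => hs; rewrite qE; exact: cox_de_boor_piece.
rewrite -derivE /q deriv_comp derivB derivZ derivX derivC subr0 alg_polyC.
rewrite hornerM hornerC mulrC horner_comp deriv_piece_scaled //.
by congr (_ * (_).[_]); rewrite !hornerE mulrC.
Qed.

Lemma B_mx_entry (T : R) p n (l j : 'I_n) : 0 < T -> (0 < p <= n)%N ->
  let N := (n.+1 - p)%N in
  B_mx T p n l j = \sum_(m < N) unit_integral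
   ((scaled_piece N p m j.+1 - scaled_piece N p m j.+2) *
    (scaled_piece N p m l - scaled_piece N p m l.+1)).
Proof.
move=> T0 /andP[p0 pn] N; rewrite mxE /Bh_entry /= -/N.
have N0 : (0 < N)%N by rewrite /N; lia.
set h := mesh_size T N.
have h0 : 0 < h by rewrite divr_gt0 // ltr0n.
have TE : T = N%:R * h by rewrite /h /mesh_size mulrCA mulfV ?mulr1 // pnatr_eq0 -lt0n.
pose q m := h ^- 2 *: ((scaled_piece N p m j.+1 - scaled_piece N p m j.+2) *
    (scaled_piece N p m l - scaled_piece N p m l.+1)).
have [|_] := @cells_integral R h
  (fun t => derive1 (bspline T N p j.+1) t * derive1 (bspline T N p l) t) q h0 N.
  move=> m mN t ht; rewrite !(derive_bspline _ T0 p0 mN ht) -/h.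
  by rewrite /q hornerZ hornerM expr2 (invfM h h); ring.
rewrite -TE => ->; rewrite mulr_sumr mulr_sumr; apply: eq_bigr => m _.
by rewrite /q linearZ /= (mulrA h h) -(expr2 h) mulVKf // expf_neq0 // gt_eqF.
Qed.

(** The trial functions have the indices [j + 1] and the test functions the
    indices [l]: this shift by one makes the same difference matrix appear on
    both sides, up to the sign. *)
Lemma B_mx_factor (T : R) p n : 0 < T -> (0 < p <= n)%N ->
  B_mx T p n =
  - (difference_mx n *m gram_mx (n.+1 - p) p n *m difference_mx n).
Proof.
move=> T0 hpn; apply/matrixP => l j; rewrite B_mx_entry //.
set N := (n.+1 - p)%N; have Np : (N + p = n.+1)%N by rewrite /N; lia.
pose phi m := scaled_piece N p m l.+1 - scaled_piece N p m l.
pose g (b : nat) := \sum_(m < N) unit_integral (phi m * scaled_piece N p m b).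
have gE (b : 'I_n) : (difference_mx n *m gram_mx N p n) l b = g b.+1.
  rewrite mxE; under eq_bigr do rewrite [gram_mx _ _ _ _ _]mxE.
  rewrite (difference_mx_row l (F := fun a => gram_entry N p a b.+1)).
    by rewrite -sumrB; apply: eq_bigr => m _; rewrite -linearB -mulrBl.
  by rewrite /gram_entry big1 // => m _; rewrite scaled_piece0 mul0r linear0.
have gn : g n.+1 = 0.
  by rewrite /g big1 // => m _; rewrite scaled_piece_last ?Np // mulr0 linear0.
rewrite mxE mxE; under [in RHS]eq_bigr do rewrite gE.
rewrite difference_mx_col // /g -sumrB -sumrN; apply: eq_bigr => m _.
rewrite -[X in _ = - X]linearB -[RHS]linearN /=; congr (unit_integral _).
by rewrite /phi; ring.
Qed.

End Gram.

(** * Boundedness and coercivity of the Gram matrix *)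

Section GramBounds.
Variable R : realType.

Lemma normr_unit_integral_le (n : nat) (q r : {poly R}) A : 0 <= A ->
  (size q <= n)%N -> (size r <= n)%N ->
  (forall k, `|q`_k| <= A) -> (forall k, `|r`_k| <= A) ->
  `|unit_integral (q * r)| <= (n + n)%:R * A ^+ 2.
Proof.
move=> A0 sq sr qA rA.
have sqr : (size (q * r)%R <= n + n)%N by have := size_polyMleq q r; lia.
rewrite (unit_integralE sqr) (le_trans (ler_norm_sum _ _ _)) //.
apply: le_trans (_ : \sum_(k < n + n) A ^+ 2 <= _); last first.
  by rewrite sumr_const card_ord mulr_natl.
apply: ler_sum => k _; rewrite normrM normfV (ger0_norm (ler0n _ _)).
rewrite ler_pdivrMr ?ltr0n // coefM (le_trans (ler_norm_sum _ _ _)) //.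
apply: le_trans (_ : \sum_(j < k.+1) A ^+ 2 <= _); last first.
  by rewrite sumr_const card_ord mulr_natr.
by apply: ler_sum => j _; rewrite normrM expr2 ler_pM.
Qed.

Lemma size_scaled_piece N p m i : (0 < p)%N ->
  (size (scaled_piece R N p m i) <= p)%N.
Proof.
move=> p0; apply: leq_trans (size_scale_leq _ _) _.
by have := size_piece R N p m p.-1 i; rewrite prednK.
Qed.

Lemma coef_scaled_piece_le N p m i k : (0 < p)%N -> (m < N)%N ->
  `|(scaled_piece R N p m i)`_k| <= p%:R * (2 ^ p.-1 * p`!)%:R.
Proof.
move=> p0 mN; rewrite -[in p`!](prednK p0) coefZ normrM ler_pM ?coef_piece_le //.
rewrite normrM (ger0_norm (ler0n _ _)) ger0_norm ?invr_ge0 ?knot_gap_ge0 //.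
by rewrite ler_piMr ?knot_gap_inv_le1.
Qed.

(** A scaled B-spline lives on at most [p] cells, whatever [N] is. *)
Lemma gram_entry_bounded p : (0 < p)%N -> exists2 K : R, 0 <= K &
  forall N a b, `|gram_entry R N p a b| <= K.
Proof.
move=> p0; pose A : R := p%:R * (2 ^ p.-1 * p`!)%:R.
have A0 : 0 <= A by rewrite mulr_ge0.
pose B : R := (p + p)%:R * A ^+ 2.
have B0 : 0 <= B by rewrite mulr_ge0 // sqr_ge0.
exists (p%:R * B) => [|N a b]; first by rewrite mulr_ge0.
pose F (m : nat) := if (m < N)%N then
  unit_integral (scaled_piece R N p m a * scaled_piece R N p m b) else 0.
apply: le_trans (ler_norm_sum _ _ _) _.
apply: le_trans (_ : \sum_(m < N) `|F m| <= _).
  by apply: ler_sum => m _; rewrite /F ltn_ord.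
apply: (@ler_sum_window _ N (a - p) p) => // m hm; rewrite /F; case: ifP => // mN.
- by apply: normr_unit_integral_le => // [||k|k];
    rewrite ?size_scaled_piece ?coef_scaled_piece_le.
- by rewrite normr0.
- by rewrite scaled_piece_notin ?mul0r ?linear0 //; lia.
Qed.

Lemma gram_mx_banded N p n : (0 < p)%N -> banded p (gram_mx R N p n).
Proof.
move=> p0 i k; apply: contraNT => hik; rewrite mxE /gram_entry big1 // => m _.
have [hi|hi] := boolP (m < i.+1 <= m + p)%N; last first.
  by rewrite scaled_piece_notin // mul0r linear0.
by rewrite [X in _ * X]scaled_piece_notin ?mulr0 ?linear0 //; lia.
Qed.

Lemma gram_mx_quadratic N p n (x : 'I_n -> R) :
  \sum_(a < n) \sum_(b < n) x a * gram_mx R N p n a b * x b =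
  \sum_(m < N) let f := \sum_(a < n) x a *: scaled_piece R N p m a.+1 in
    unit_integral (f * f).
Proof.
under eq_bigr => a _.
  under eq_bigr => b _.
    rewrite mxE /gram_entry mulr_sumr mulr_suml; over.
  rewrite exchange_big; over.
rewrite exchange_big; apply: eq_bigr => m _ /=.
rewrite mulr_suml linear_sum; apply: eq_bigr => a _.
rewrite mulr_sumr linear_sum; apply: eq_bigr => b _.
move: (scaled_piece _ _ _ _ a.+1) (scaled_piece _ _ _ _ b.+1) => u v.
by rewrite -[in RHS]scalerAr -[in RHS]scalerAl !linearZ /= /GRing.scale /=; ring.
Qed.

(** On each cell, [piece_stable] and [coef_le_unit_integral] bound the entries of
    [x] that are active there by the local energy.  Each entry is active on some
    cell, and each cell has at most [p] active entries. *)
Lemma gram_mx_coercive p : (0 < p)%N -> exists2 c : R, 0 < c &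
  forall N n, (0 < N)%N -> (N + p = n.+1)%N -> coercive c (gram_mx R N p n).
Proof.
move=> p0; have [C1 C1_gt0 coefI] := @coef_le_unit_integral R p.
have [C2 C2_gt0 stab] := @piece_stable R p.-1.
have C_gt0 : 0 < p%:R * (C2 ^+ 2 * C1) by rewrite !mulr_gt0 ?exprn_gt0 ?ltr0n.
exists (p%:R * (C2 ^+ 2 * C1))^-1 => [|N n N0 Nn x]; first by rewrite invr_gt0.
rewrite gram_mx_quadratic mulrC ler_pdivrMr // mulrC.
pose f m := \sum_(a < n) x a *: scaled_piece R N p m a.+1.
rewrite -/(f _).
pose X k := if insub k is Some a then x a else 0 : R.
have XE (a : 'I_n) : X a = x a by rewrite /X valK.
pose active m a := (m < a.+1 <= m + p)%N.
have local m (a : 'I_n) : (m < N)%N -> active m a ->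
    x a ^+ 2 <= C2 ^+ 2 * C1 * unit_integral (f m * f m).
  move=> mN act; pose c i := p%:R * (knot_gap R N p p i)^-1 * X i.-1.
  have fE : f m = \sum_(i < n.+1) c i *: piece R N p m p.-1 i.
    rewrite big_ord_recl [c 0%N]/c knot_gap_nat /knot_index add0n subnn sub0n.
    rewrite subnn invr0 mulr0 mul0r scale0r add0r; apply: eq_bigr => b _.
    by rewrite /c /scaled_piece scalerA -XE mulrC.
  set I := unit_integral _.
  have I0 : 0 <= I by exact: unit_integral_sqr_ge0.
  have sf : (size (f m) <= p)%N.
    apply: leq_trans (size_sum _ _ _) _; apply/bigmax_leqP => b _.
    exact: leq_trans (size_scale_leq _ _) (size_scaled_piece _ _ _ p0).
  have coefA k : `|(f m)`_k| <= Num.sqrt (C1 * I).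
    by rewrite -sqrtr_sqr ler_wsqrtr // coefI.
  have := stab N p m n.+1 c (Num.sqrt (C1 * I)).
  rewrite -fE => /(_ _ _ _ coefA a.+1) stab_a.
  have {stab_a} : `|c a.+1| <= C2 * Num.sqrt (C1 * I).
    by move: act; rewrite /active => act; apply: stab_a; lia.
  (* A gap of [p] steps is at most [p], so the scaling only enlarges [x a]. *)
  rewrite /c /= XE => ca.
  have xc : `|x a| <= C2 * Num.sqrt (C1 * I).
    apply: le_trans ca; rewrite normrM ler_peMl //.
    have gpos : 0 < knot_gap R N p p a.+1.
      move: act; rewrite /active => act.
      by rewrite knot_gap_nat ltr0n /knot_index; lia.
    rewrite ger0_norm ?mulr_ge0 ?invr_ge0 ?(ltW gpos) //.
    by rewrite ler_pdivlMr // mul1r knot_gap_le.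
  rewrite -real_normK ?num_real //.
  have -> : C2 ^+ 2 * C1 * I = (C2 * Num.sqrt (C1 * I)) ^+ 2.
    by rewrite exprMn sqr_sqrtr ?mulrA // mulr_ge0 // ltW.
  by rewrite ler_sqr ?nnegrE // mulr_ge0 ?sqrtr_ge0 // ltW.
pose F m a := if active m a then X a ^+ 2 else 0 : R.
have F0 m a : 0 <= F m a by rewrite /F; case: ifP => _ //; exact: sqr_ge0.
apply: le_trans (_ : \sum_(a < n) \sum_(m < N) F m a <= _).
  apply: ler_sum => a _.
  (* The last [p] entries are all active on the last cell. *)
  have mN : (minn a N.-1 < N)%N by lia.
  rewrite (bigD1 (Ordinal mN)) //= {1}/F /active.
  have -> : (minn a N.-1 < a.+1 <= minn a N.-1 + p)%N.
    by have := ltn_ord a; lia.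
  by rewrite XE lerDl sumr_ge0.
rewrite exchange_big mulr_sumr; apply: ler_sum => m _.
under eq_bigr => a _ do rewrite -[F _ _](ger0_norm (F0 _ _)).
rewrite -mulrA; apply: (@ler_sum_window _ n m p (F m)).
- by rewrite mulr_ge0 ?unit_integral_sqr_ge0 // mulr_ge0 ?sqr_ge0 // ltW.
- move=> a ha; rewrite ger0_norm // /F; case: ifP => [act|_].
    rewrite /X; case: insubP => [b _ ba|_]; last first.
      rewrite expr0n /= mulr_ge0 ?unit_integral_sqr_ge0 //.
      by rewrite mulr_ge0 ?sqr_ge0 // ltW.
    by apply: local; rewrite // -[nat_of_ord b]/(val b) ba.
  rewrite mulr_ge0 ?unit_integral_sqr_ge0 //.
  by rewrite mulr_ge0 ?sqr_ge0 // ltW.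
- by move=> a ha; rewrite /F /active; case: ifP => // ?; lia.
Qed.
End GramBounds.

(** * Operator norms and conclusion *)

Section OperatorNorms.
Variable R : realType.

Definition col_sum_le n (a : R) (A : 'M[R]_n) :=
  forall j, \sum_(i < n) `|A i j| <= a.

Lemma col_sum_le_mul n (a b : R) (A B : 'M[R]_n) : 0 <= a ->
  col_sum_le a A -> col_sum_le b B -> col_sum_le (a * b) (A *m B).
Proof.
move=> a0 hA hB j.
apply: le_trans (_ : \sum_(i < n) \sum_(k < n) `|A i k| * `|B k j| <= _).
  apply: ler_sum => i _; rewrite mxE (le_trans (ler_norm_sum _ _ _)) //.
  by apply: ler_sum => k _; rewrite normrM.
rewrite exchange_big; apply: le_trans (_ : \sum_(k < n) a * `|B k j| <= _).
  by apply: ler_sum => k _; rewrite -mulr_suml; apply: ler_wpM2r; last exact: hA.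
by rewrite -mulr_sumr; apply: ler_wpM2l => //; exact: hB.
Qed.

Lemma col_sum_le_opp n (a : R) (A : 'M[R]_n) : col_sum_le a A -> col_sum_le a (- A).
Proof. by move=> hA j; under eq_bigr do rewrite mxE normrN; exact: hA. Qed.

Lemma col_sum_le_entry n (a : R) (A : 'M[R]_n) : col_sum_le a A ->
  forall i j, `|A i j| <= a.
Proof.
move=> hA i j; apply: le_trans (hA j).
by rewrite (bigD1 i) //= lerDl sumr_ge0.
Qed.

Lemma vec_norm0 q n : vec_norm q (0 : 'cV[R]_n) = 0.
Proof.
case: q => /=.
- by rewrite big1 // => i _; rewrite mxE normr0.
- by rewrite big1 ?sqrtr0 // => i _; rewrite mxE normr0 expr0n.
- by apply: (big_ind (fun y => y = 0)) => [//|y z -> ->|i _];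
    rewrite ?maxxx ?mxE ?normr0.
Qed.

Lemma entry_le_vec_norm q n (x : 'cV[R]_n) i : `|x i 0| <= vec_norm q x.
Proof.
case: q => /=.
- by rewrite (bigD1 i) //= lerDl sumr_ge0.
- rewrite -[leLHS]sqrtr_sqr ler_sqrt; last by apply: sumr_ge0 => k _; exact: sqr_ge0.
  rewrite (bigD1 i) //= -[leLHS]real_normK ?num_real // lerDl.
  by rewrite sumr_ge0 // => k _; exact: sqr_ge0.
- exact: (le_bigmax _ (fun i => `|x i 0|)).
Qed.

Lemma vec_norm_le q n (x : 'cV[R]_n) b : 0 <= b ->
  (forall i, `|x i 0| <= b) -> vec_norm q x <= n%:R * b.
Proof.
move=> b0 xb; case: q => /=.
- apply: le_trans (ler_sum _ (fun i _ => xb i)) _.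
  by rewrite sumr_const card_ord mulr_natl.
- rewrite -[leRHS]ger0_norm ?mulr_ge0 // -sqrtr_sqr ler_wsqrtr //.
  apply: le_trans (_ : \sum_(i < n) b ^+ 2 <= _).
    by apply: ler_sum => i _; rewrite ler_sqr ?nnegrE.
  rewrite sumr_const card_ord -[leLHS]mulr_natl exprMn ler_wpM2r ?sqr_ge0 //.
  by rewrite -natrX ler_nat; case: n {x xb} => // n; rewrite leq_pmull.
- apply: bigmax_le => [|i _]; first by rewrite mulr_ge0.
  apply: le_trans (xb i) _; rewrite ler_peMl // ler1n.
  by apply: leq_ltn_trans (ltn_ord i).
Qed.

(** The supremum that defines the norm is only meaningful for a bounded set; it
    is then nonnegative because the zero vector is in the unit ball. *)
Lemma op_norm_bound q n (A : 'M[R]_n) b :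
  (forall x : 'cV[R]_n, vec_norm q x <= 1 -> vec_norm q (A *m x) <= b) ->
  0 <= op_norm q A <= b.
Proof.
move=> Ab; apply/andP; split.
  apply: ub_le_sup; first by exists b => _ [x /= x1 <-]; exact: Ab.
  by exists 0 => /=; rewrite ?mulmx0 ?vec_norm0.
apply: ge_sup; last by move=> _ [x /= x1 <-]; exact: Ab.
by exists 0, 0 => /=; rewrite ?mulmx0 ?vec_norm0.
Qed.

Lemma op_norm_one_bound n (A : 'M[R]_n) a : 0 <= a -> col_sum_le a A ->
  0 <= op_norm norm_one A <= a.
Proof.
move=> a0 hA; apply: op_norm_bound => x /= x1.
apply: le_trans (_ : \sum_(i < n) \sum_(k < n) `|A i k| * `|x k 0| <= _).
  apply: ler_sum => i _; rewrite mxE (le_trans (ler_norm_sum _ _ _)) //.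
  by apply: ler_sum => k _; rewrite normrM.
rewrite exchange_big; apply: le_trans (_ : \sum_(k < n) a * `|x k 0| <= _).
  by apply: ler_sum => k _; rewrite -mulr_suml; apply: ler_wpM2r; last exact: hA.
by rewrite -mulr_sumr ler_piMr.
Qed.

(** A crude estimate valid for the three norms at once: it costs a factor [n^2],
    harmless for an algebraic bound. *)
Lemma op_norm_entry_bound q n (A : 'M[R]_n) a : 0 <= a ->
  (forall i j, `|A i j| <= a) -> 0 <= op_norm q A <= n%:R ^+ 2 * a.
Proof.
move=> a0 hA; apply: op_norm_bound => x x1; rewrite expr2 -mulrA.
apply: vec_norm_le => [|i]; first by rewrite mulr_ge0.
rewrite mxE (le_trans (ler_norm_sum _ _ _)) //.
apply: le_trans (_ : \sum_(k < n) a <= _).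
  apply: ler_sum => k _; rewrite normrM -[leRHS]mulr1 ler_pM //.
  exact: le_trans (entry_le_vec_norm q x k) x1.
by rewrite sumr_const card_ord mulr_natl.
Qed.

Lemma difference_mx_col_sum n : col_sum_le 2 (difference_mx R n).
Proof.
move=> j; apply: le_trans
  (_ : \sum_(i < n) (`|(i == j)%:R| + `|(i == j.+1 :> nat)%:R|) <= _).
  by apply: ler_sum => i _; rewrite mxE; exact: ler_normB.
rewrite big_split /= -[leRHS](_ : 1%:R * 1 + 1%:R * 1 = 2); last by rewrite !mulr1.
have win (k : nat) : \sum_(i < n) `|(i == k :> nat)%:R : R| <= 1%:R * 1.
  apply: (@ler_sum_window _ n k 1 (fun i => (i == k)%:R)) => // i hi.
  - by case: eqP; rewrite ?normr1 ?normr0.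
  - by case: eqP => // ik; move: hi; rewrite ik; lia.
by apply: lerD; exact: win.
Qed.

Lemma cumulative_mx_col_sum n : col_sum_le n%:R (cumulative_mx R n).
Proof.
move=> j; apply: le_trans (_ : \sum_(i < n) 1 <= _).
  by apply: ler_sum => i _; rewrite mxE; case: (_ <= _)%N; rewrite ?normr1 ?normr0.
by rewrite sumr_const card_ord.
Qed.

Lemma invmx_difference_congr n (G : 'M[R]_n) : G \in unitmx ->
  let B := - (difference_mx R n *m G *m difference_mx R n) in
  B \in unitmx /\
  invmx B = - (cumulative_mx R n *m invmx G *m cumulative_mx R n).
Proof.
move=> Gu B; set X := - _.
have BX : B *m X = 1%:M.
  rewrite mulNmx mulmxN opprK -!mulmxA (mulmxA (difference_mx R n) (cumulative_mx R n)).
  by rewrite difference_cumulative mul1mx (mulmxA G) mulmxV // mul1mx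
    difference_cumulative.
have [Bu _] := mulmx1_unit BX; split=> //.
by rewrite -[RHS](mulKmx Bu) BX mulmx1.
Qed.

(** The two cumulative sum matrices contribute [n] each to the inverse. *)
Lemma B_mx_bounds p (T : R) : 0 < T -> (0 < p)%N ->
  exists2 b : R, 0 <= b & exists2 C : R, 0 <= C &
  forall n, (p <= n)%N ->
  [/\ B_mx T p n \in unitmx, col_sum_le b (B_mx T p n) &
      col_sum_le (C * n%:R ^+ 2) (invmx (B_mx T p n))].
Proof.
move=> T0 p0.
have [K K0 GK] := @gram_entry_bounded R p p0.
have [c c0 coG] := @gram_mx_coercive R p p0.
have [C C0 invG] := @banded_inverse_col_sum R c K p c0 K0.
pose g : R := (p + p)%:R * K; have g0 : 0 <= g by rewrite mulr_ge0.
exists (2 * g * 2); first by rewrite !mulr_ge0.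
exists C => // n pn.
set G := gram_mx R (n.+1 - p) p n.
have coGn : coercive c G by apply: coG; lia.
have bandG : banded p G by exact: gram_mx_banded.
have entG i k : `|G i k| <= K by rewrite mxE; exact: GK.
have [Bu invB] := invmx_difference_congr (coercive_unitmx c0 coGn).
rewrite B_mx_factor ?p0 // -/G invB; split=> //.
  apply: col_sum_le_opp; apply: col_sum_le_mul; first by rewrite mulr_ge0.
    apply: col_sum_le_mul; [by []|exact: difference_mx_col_sum|].
    move=> k; apply: (@band_row_sum R n p K (fun a b => G b a) K0) => [a b|a b].
      exact: entG.
    by move=> /bandG; rewrite andbC.
  exact: difference_mx_col_sum.
rewrite (_ : C * n%:R ^+ 2 = n%:R * C * n%:R); last by ring.
apply: col_sum_le_opp; apply: col_sum_le_mul; first by rewrite mulr_ge0.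
  by apply: col_sum_le_mul; [|exact: cumulative_mx_col_sum|exact: invG].
exact: cumulative_mx_col_sum.
Qed.

End OperatorNorms.

Theorem proposition3p12 (R : realType) (T : R) (hT : 0 < T)
    (p : nat) (hp : (1 <= p)%N) :
  weakly_well_conditioned (B_mx T p) /\
  (fun n : nat => cond_number norm_one (B_mx T p n))
    =O_\oo (fun n : nat => n%:R ^+ 2 : R).
Proof.
have [b b0 [C C0 bounds]] := B_mx_bounds hT hp.
have bC0 : 0 <= b * C by rewrite mulr_ge0.
split; first split.
- by exists p => // n /= pn; have [] := bounds n pn.
- (* The crude norm bounds multiply the growth n^2 by n^2 twice. *)
  move=> q; exists 6; first by [].
  apply/eqO_exP; exists (b * C + 1); first by rewrite ltr_wpDl.
  exists p => // n /= pn; have [_ hB hI] := bounds n pn.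
  have /andP[nB0 nBb] := op_norm_entry_bound q b0 (col_sum_le_entry hB).
  have bI0 : 0 <= C * n%:R ^+ 2 by rewrite mulr_ge0 // sqr_ge0.
  have /andP[nI0 nIb] := op_norm_entry_bound q bI0 (col_sum_le_entry hI).
  rewrite ger0_norm ?mulr_ge0 // ger0_norm ?powR_ge0 // powR_mulrn //.
  apply: le_trans (ler_pM nB0 nI0 nBb nIb) _.
  rewrite [leLHS](_ : _ = b * C * n%:R ^+ 6); last by ring.
  by rewrite ler_wpM2r ?exprn_ge0 // lerDl.
- apply/eqO_exP; exists (b * C + 1); first by rewrite ltr_wpDl.
  exists p => // n /= pn; have [_ hB hI] := bounds n pn.
  have /andP[nB0 nBb] := op_norm_one_bound b0 hB.
  have bI0 : 0 <= C * n%:R ^+ 2 by rewrite mulr_ge0 // sqr_ge0.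
  have /andP[nI0 nIb] := op_norm_one_bound bI0 hI.
  rewrite ger0_norm ?mulr_ge0 // ger0_norm ?sqr_ge0 //.
  apply: le_trans (ler_pM nB0 nI0 nBb nIb) _.
  by rewrite mulrA ler_wpM2r ?sqr_ge0 // lerDl.
Qed.
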